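(* Let $\tilde F_k$ ($k\ge 1$) be the stable cluster variables of the framed conifold quiver with mutation sequence $(0,1,0,1,\ldots)$, as defined in the context. Then $\lim_{k\to\infty}\tilde F_k$ converges as a formal power series in $y_0,y_1$; that is, for every monomial in $y_0,y_1$, its coefficient in $\tilde F_k$ is constant for all sufficiently large $k$.
   Context: Framed conifold quiver $Q_0$: vertices $0,1$ and frozen vertices $0',1'$ (never mutated); arrows: two arrows $0\to 1$, two arrows $1\to 0$, one arrow $0\to 0'$, one arrow $1\to 1'$. Initial labels: $1$ at vertices $0$ and $1$, $y_0$ at $0'$, $y_1$ at $1'$. Mutation at a vertex $v\in\{0,1\}$: (1) replace the label $\ell_v$ by $\bigl(\prod_{\text{arrows } u\to v}\ell_u+\prod_{\text{arrows } v\to u}\ell_u\bigr)/\ell_v$ (products over arrows with multiplicity, using the arrows before mutation); (2) for every 2-path $u\to v\to w$ add an arrow $u\to w$; (3) remove all self-loops created, and cancel in pairs the 2-cycles created between a non-frozen and a frozen vertex (the 2-cycles between $0$ and $1$, namely two arrows in each direction, are kept); (4) reverse all arrows incident to $v$. Mutate successively at $0,1,0,1,\ldots$; $Q_k$ is the quiver after $k$ mutations and $F_k$ is the new label produced at the $k$-th mutation (a polynomial in $y_0,y_1$, the $k$-th F-polynomial). C-matrix: $C_k$ is the $2\times 2$ matrix, indexed by $0,1$, whose $(i,j)$ entry is the number of arrows $i'\to j$ in $Q_k$ (negative if the arrows point $j\to i'$). The $C_k$-matrix transformation sends a monomial $y_0^{a_0}y_1^{a_1}$ to $y_0^{b_0}y_1^{b_1}$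 with $\vec b=C_k^{-1}\vec a$, extended linearly; $\tilde F_k$ is the image of $F_k$. Convention on parity: for odd $k$ one has $C_k=C_k^{-1}=\begin{bmatrix}k&-(k+1)\\k-1&-k\end{bmatrix}$, while for even $k$ the matrix $C_k^{-1}$ is this same expression with its two rows interchanged. To remove the resulting alternation between $y_0$ and $y_1$, the odd form is used for all $k$; that is, for every $k\ge 1$, $\tilde F_k$ is obtained from $F_k$ by replacing each monomial $y_0^{a}y_1^{b}$ by $y_0^{ka-(k+1)b}\,y_1^{(k-1)a-kb}$. *)

(* Defs.v *)
From HB Require Import structures.
From mathcomp Require Import all_boot all_order all_algebra.
From mathcomp Require Import perm fraction.
From mathcomp Require Import freeg mpoly.
From mathcomp Require Import zify.

Set Implicit Arguments.
Unset Strict Implicit.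
Unset Printing Implicit Defensive.

Import GRing.Theory.
Local Open Scope ring_scope.

(* [inl i] is the mutable vertex i and [inr i] is the frozen vertex i'. *)
Definition vertex : finType := ('I_2 + 'I_2)%type.

Definition frozen (u : vertex) : bool := if u is inr _ then true else false.

(* [q u w] is the number of arrows u -> w; 2-cycles are allowed. *)
Definition quiver := vertex -> vertex -> nat.

Definition Q0 : quiver := fun u w =>
  match u, w with
  | inl i, inl j => if i == j then 0%N else 2%N
  | inl i, inr j => (i == j)%N
  | inr _, _ => 0%N
  end.

Definition add_paths (v : vertex) (q : quiver) : quiver :=
  fun u w => (q u w + q u v * q v w)%N.

(* The subtraction is truncated, so a mutable-frozen pair of vertices keeps
   only its net arrows; the 2-cycles between 0 and 1 are left alone. *)
Definition cancel_cycles (q : quiver) : quiver := fun u w =>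
  if u == w then 0%N
  else if frozen u (+) frozen w then (q u w - q w u)%N
  else q u w.

Definition reverse_at (v : vertex) (q : quiver) : quiver := fun u w =>
  if (u == v) || (w == v) then q w u else q u w.

Definition mutate_quiver (v : vertex) (q : quiver) : quiver :=
  reverse_at v (cancel_cycles (add_paths v q)).

Definition ratfun := {fraction {mpoly int[2]}}.

Definition labelling := vertex -> ratfun.

Definition mutate_label (v : vertex) (q : quiver) (l : labelling) : labelling :=
  fun u => if u == v then
    (\prod_(w : vertex) l w ^+ q w v + \prod_(w : vertex) l w ^+ q v w) / l v
  else l u.

Definition label0 : labelling := fun u =>
  if u is inr i then tofrac ('X_i : {mpoly int[2]}) else 1.

(* The vertex of the (k+1)-st mutation. *)
Definition mut_vertex (k : nat) : 'I_2 := if odd k then 1 else 0.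

Fixpoint Q (k : nat) : quiver :=
  if k is k'.+1 then mutate_quiver (inl (mut_vertex k')) (Q k') else Q0.

Fixpoint label (k : nat) : labelling :=
  if k is k'.+1 then mutate_label (inl (mut_vertex k')) (Q k') (label k')
  else label0.

(* Meaningful for [0 < k]; the F-polynomial as a rational function. *)
Definition Flabel (k : nat) : ratfun := label k (inl (mut_vertex k.-1)).

Definition Cmx (k : nat) : 'M[int]_2 := \matrix_(i, j)
  ((Q k (inr i) (inl j))%:Z - (Q k (inl j) (inr i))%:Z).

(* For even k the two rows are interchanged, so that the same closed form
   [odd_form] holds for all k > 0: this is [stable_mxE] below. *)
Definition stable_mx (k : nat) : 'M[int]_2 :=
  if odd k then invmx (Cmx k) else xrow 0 1 (invmx (Cmx k)).

(* Laurent polynomials in two variables: the free Z-module on Z^2, where the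
   basis vector e stands for y_0 ^ e_0 * y_1 ^ e_1. *)
Definition laurent := {freeg 'cV[int]_2 / int}.

Definition exponent (m : 'X_{1..2}) : 'cV[int]_2 := \col_i (m i)%:Z.

Definition transform (M : 'M[int]_2) (p : {mpoly int[2]}) : laurent :=
  \sum_(m <- msupp p) << p@_m *g M *m exponent m >>.

Definition nonneg_exponents (g : laurent) : Prop :=
  forall e : 'cV[int]_2, (exists i, e i 0 < 0) -> coeff e g = 0.

Definition odd_form (k : nat) : 'M[int]_2 := \matrix_(i, j)
  if i == 0 then (if j == 0 then k%:Z else - k.+1%:Z)
  else (if j == 0 then k%:Z - 1 else - k%:Z).

Lemma ord2_ind (P : 'I_2 -> Prop) : P 0 -> P 1 -> forall i, P i.
Proof.
move=> P0 P1 [[|[|n]] Hn] //.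
- by rewrite (_ : Ordinal Hn = 0) //; apply: val_inj.
- by rewrite (_ : Ordinal Hn = 1) //; apply: val_inj.
Qed.

Lemma QE (k : nat) (u w : vertex) : Q k.+1 u w =
  match u, w with
  | inl i, inl j => if i == j then 0%N else 2%N
  | inl j, inr i => if j == mut_vertex k then 0%N else (k.+2 - i)%N
  | inr i, inl j => if j == mut_vertex k then (k.+1 - i)%N else 0%N
  | inr _, inr _ => 0%N
  end.
Proof.
elim: k u w => [|k IH] u w.
  by case: u; case: w; elim/ord2_ind; elim/ord2_ind.
have -> : Q k.+2 u w =
    mutate_quiver (inl (mut_vertex k.+1)) (Q k.+1) u w by [].
rewrite /mutate_quiver /reverse_at /cancel_cycles /add_paths.
rewrite !IH /mut_vertex /=.
by case: u; case: w; elim/ord2_ind; elim/ord2_ind; case: (odd k) => /=; lia.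
Qed.

Lemma stable_mxE (k : nat) : (0 < k)%N -> stable_mx k = odd_form k.
Proof.
case: k => // k _.
have invP (A B : 'M[int]_2) : A *m B = 1%:M -> invmx A = B.
  move=> AB; have [uA _] := mulmx1_unit AB.
  by rewrite -[LHS]mulmx1 -AB mulKmx.
have swap (A : 'M[int]_2) : xrow 0 1 (xrow 0 1 A) = A.
  by apply/matrixP => i j; rewrite !mxE tpermK.
rewrite /stable_mx; case: ifP => ok.
  apply: invP; apply/matrixP; elim/ord2_ind; elim/ord2_ind;
  by rewrite !mxE !big_ord_recl big_ord0 !mxE !QE /mut_vertex;
     move: ok => /= /negbTE -> /=; rewrite ?modn_small ?subn1 /=; lia.
rewrite -(swap (odd_form _)); congr (xrow _ _ _).
apply: invP; apply/matrixP; elim/ord2_ind; elim/ord2_ind;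
by rewrite !mxE !big_ord_recl big_ord0 !mxE !QE /mut_vertex;
   move: ok => /= /negbFE ->; rewrite ?permE /= ?modn_small ?subn1 /=; lia.
Qed.

(* Main.v *)
(* The exchange relation reads F_(k+1) F_(k-1) = F_k^2 (1 + y_0^(k+1) y_1^k),
   so the quotients F_k / F_(k-1) telescope and
     F_k = prod_(1 <= i <= k) (1 + y_0^i y_1^(i-1))^(k+1-i).
   The linear substitution sends y_0^i y_1^(i-1) to y_0^n y_1^(n-1) with
   n = k+1-i, hence the stable variable is
     prod_(1 <= n <= k) (1 + y_0^n y_1^(n-1))^n;
   passing from k to k+1 only changes coefficients of degree at least 2k+1. *)
Require Import Defs.
From mathcomp Require Import all_boot all_order all_algebra.
From mathcomp Require Import fraction.
From mathcomp Require Import freeg mpoly.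
From mathcomp Require Import zify ring.

Set Implicit Arguments.
Unset Strict Implicit.
Unset Printing Implicit Defensive.

Import GRing.Theory.
Local Open Scope ring_scope.

Lemma exponent_inj : injective exponent.
Proof.
move=> m1 m2 /matrixP e; apply/mnmP => i.
by move: (e i 0); rewrite !mxE => -[].
Qed.

Lemma exponentD (m1 m2 : 'X_{1..2}) :
  exponent (m1 + m2)%MM = exponent m1 + exponent m2.
Proof. by apply/matrixP => i j; rewrite !mxE mnmDE PoszD. Qed.

(** Monomials outside the support contribute zero, so several polynomials can be summed over one
    common list; additivity of [transform] rests on this. *)
Lemma transform_wide (M : 'M[int]_2) (p : {mpoly int[2]}) (s : seq 'X_{1..2}) :
  uniq s -> {subset msupp p <= s} ->
  transform M p = \sum_(m <- s) << p@_m *g M *m exponent m >>.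
Proof.
move=> us sub; rewrite [RHS](bigID (mem (msupp p))) /= [X in _ + X]big1 ?addr0.
  rewrite -big_filter; apply: perm_big; apply: uniq_perm; rewrite ?filter_uniq //.
  by move=> m; rewrite mem_filter; case: (boolP (m \in msupp p)) => // /sub ->.
by move=> m /memN_msupp_eq0 ->; rewrite freegU0.
Qed.

Lemma transformD (M : 'M[int]_2) (p q : {mpoly int[2]}) :
  transform M (p + q) = transform M p + transform M q.
Proof.
pose s := undup (msupp p ++ msupp q).
have us : uniq s by apply: undup_uniq.
rewrite !(@transform_wide _ _ s) // -?big_split /=.
- by apply: eq_bigr => m _; rewrite mcoeffD freegUD.
- by move=> m mq; rewrite mem_undup mem_cat mq orbT.
- by move=> m mp; rewrite mem_undup mem_cat mp.
- by move=> m; rewrite mem_undup; apply: msuppD_le.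
Qed.

Lemma coeff_transformMX (M : 'M[int]_2) (p : {mpoly int[2]}) a e :
  coeff e (transform M (p * 'X_[a])) = coeff (e - M *m exponent a) (transform M p).
Proof.
rewrite /transform (perm_big _ (msuppMX p a)) big_map !raddf_sum /=.
apply: eq_bigr => m _.
by rewrite mcoeffMX !coeffU exponentD mulmxDr [in RHS]eq_sym subr_eq eq_sym addrC.
Qed.

(** Multiplication by ['X_[a]] translates Laurent exponents by [M *m exponent a], and only this
    vector matters. *)
Lemma transform_mul1X (M N : 'M[int]_2) (p q : {mpoly int[2]}) a b :
    M *m exponent a = N *m exponent b -> transform M p = transform N q ->
  transform M (p * (1 + 'X_[a])) = transform N (q * (1 + 'X_[b])).
Proof.
move=> eab epq; rewrite !mulrDr !mulr1 !transformD epq; congr (_ + _).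
by apply/eqP/freeg_eqP => e; rewrite !coeff_transformMX eab epq.
Qed.

(** Plays the role of multiplicativity: [laurent] is used only as a module, so two substituted
    products are compared factor by factor instead of being multiplied there. *)
Lemma transform_prod (I : eqType) (r : seq I) (M N : 'M[int]_2)
    (a b : I -> 'X_{1..2}) (n : I -> nat) :
    (forall i, i \in r -> M *m exponent (a i) = N *m exponent (b i)) ->
  transform M (\prod_(i <- r) (1 + 'X_[a i]) ^+ n i) =
  transform N (\prod_(i <- r) (1 + 'X_[b i]) ^+ n i).
Proof.
elim: r => [|i r IH] eab.
  rewrite !big_nil /transform msupp1 !big_seq1 mcoeff1 eqxx.
  have e0 : exponent 0%MM = 0 by apply/matrixP => i j; rewrite !mxE mnmE.
  by rewrite e0 !mulmx0.
rewrite !big_cons; have := eab i (mem_head _ _).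
move: (n i) => k eabi; elim: k => [|k IHk].
  by rewrite !mul1r IH // => j jr; apply: eab; rewrite inE jr orbT.
by rewrite !exprSr -!mulrA !(mulrC (1 + _)) !mulrA; apply: transform_mul1X.
Qed.

Lemma coeff_transform1 (p : {mpoly int[2]}) m :
  coeff (exponent m) (transform 1%:M p) = p@_m.
Proof.
have [mp|mNp] := boolP (m \in msupp p); last first.
  rewrite (memN_msupp_eq0 mNp) raddf_sum; apply: big1_seq => /= m' m'p.
  rewrite mul1mx coeffU; case: eqP => [/exponent_inj mm'|_]; last by rewrite mulr0.
  by rewrite -mm' m'p in mNp.
rewrite raddf_sum (bigD1_seq m) ?msupp_uniq //= mul1mx coeffU eqxx mulr1.
rewrite big1 ?addr0 // => m' ne; rewrite mul1mx coeffU.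
by rewrite (inj_eq exponent_inj) (negbTE ne) mulr0.
Qed.

Lemma transform1_nonneg (p : {mpoly int[2]}) : nonneg_exponents (transform 1%:M p).
Proof.
move=> e [i ei]; rewrite raddf_sum big1 //= => m _; rewrite mul1mx coeffU.
by case: eqP => [E|_]; [move: ei; rewrite -E mxE | rewrite mulr0].
Qed.

(** Every monomial of a multiple of ['X_[a]] has degree at least [mdeg a], so only the summand 1 of
    each factor reaches [m]. *)
Lemma mcoeff_mul1X (n : nat) (R : nzRingType) (p : {mpoly R[n]}) (a m : 'X_{1..n}) k :
  (mdeg m < mdeg a)%N -> (p * (1 + 'X_[a]) ^+ k)@_m = p@_m.
Proof.
move=> lt_ma; elim: k => [|k IH]; first by rewrite mulr1.
rewrite exprSr mulrA mulrDr mulr1 mcoeffD IH [X in _ + X]memN_msupp_eq0 ?addr0 //.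
rewrite (perm_mem (msuppMX _ _)); apply/mapP => -[m' _ E].
by move: lt_ma; rewrite E mdegD ltnNge leq_addr.
Qed.

(* Indices are shifted by one: this is the monomial y_0^(i+1) y_1^i. *)
Definition step_mnm (i : nat) : 'X_{1..2} := [multinom (i.+1 - j)%N | j < 2].

Lemma mdeg_step_mnm i : mdeg (step_mnm i) = (i.*2).+1.
Proof. by rewrite mdegE !big_ord_recl big_ord0 !mnmE /= /bump /=; lia. Qed.

Definition Fpoly (k : nat) : {mpoly int[2]} :=
  \prod_(i < k) (1 + 'X_[step_mnm i]) ^+ (k - i).

Definition stable_poly (k : nat) : {mpoly int[2]} :=
  \prod_(i < k) (1 + 'X_[step_mnm i]) ^+ i.+1.

Lemma Fpoly_step k :
  Fpoly k.+1 = Fpoly k * \prod_(i < k.+1) (1 + 'X_[step_mnm i]).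
Proof.
rewrite /Fpoly !big_ord_recr /= subSnn expr1 mulrA -big_split /=.
by congr (_ * _); apply: eq_bigr => i _; rewrite -exprSr subSn // ltnW.
Qed.

Lemma Fpoly_exchange k :
  Fpoly k.+2 * Fpoly k = Fpoly k.+1 ^+ 2 * (1 + 'X_[step_mnm k.+1]).
Proof. by rewrite (Fpoly_step k.+1) big_ord_recr (Fpoly_step k) /=; ring. Qed.

Lemma Fpoly_neq0 k : Fpoly k != 0.
Proof.
(* Each factor has constant term 1, since [step_mnm i] has positive degree. *)
apply/prodf_neq0 => i _; apply: expf_neq0; apply/eqP => /mpolyP /(_ 0%MM).
rewrite mcoeffD mcoeff1 mcoeffX mcoeff0 eqxx.
by case: eqP => // E; have := mdeg_step_mnm i; rewrite E mdeg0.
Qed.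

Lemma lift_ord0 : fintype.lift ord0 ord0 = 1 :> 'I_2.
Proof. exact: val_inj. Qed.

Lemma mpolyX_step k :
  'X_[step_mnm k] = 'X_0 ^+ k.+1 * 'X_1 ^+ k :> {mpoly int[2]}.
Proof.
by rewrite mpolyXE_id !big_ord_recl big_ord0 mulr1 !mnmE lift_ord0 subn0 subn1.
Qed.

Lemma labelE k :
  [/\ label k.+1 (inl (mut_vertex k)) = tofrac (Fpoly k.+1),
      label k.+1 (inl (mut_vertex k.+1)) = tofrac (Fpoly k)
    & forall i, label k.+1 (inr i) = tofrac 'X_i].
Proof.
have prod_vertex (f : vertex -> ratfun) :
    \prod_w f w = f (inl 0) * f (inl 1) * (f (inr 0) * f (inr 1)).
  by rewrite big_sumType /= !big_ord_recl !big_ord0 !mulr1 lift_ord0.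
elim: k => [|k [IH1 IH2 IH3]].
  split=> //; last by rewrite /Fpoly big_ord0 rmorph1.
  rewrite /label /mutate_label eqxx !prod_vertex /= /Fpoly big_ord1 mpolyX_step.
  by rewrite !expr0 !expr1 !expr1n !mulr1 !mul1r divr1 rmorphD rmorph1.
have -> : label k.+2 =
    mutate_label (inl (mut_vertex k.+1)) (Q k.+1) (label k.+1) by [].
split=> [||i]; rewrite /mutate_label ?eqxx ?IH3 //.
  (* By [QE], the vertex being mutated has two arrows each way with the other mutable vertex,
     [k.+2 - i] arrows to each frozen [i'] and none back. The numerator is thus the right side of
     [Fpoly_exchange]. *)
  rewrite IH2; apply: (canLR (mulfK _)); first by rewrite tofrac_eq0 Fpoly_neq0.
  rewrite -tofracM Fpoly_exchange mpolyX_step !prod_vertex !QE !IH3.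
  rewrite tofracM tofracXn tofracD tofrac1 tofracM !tofracXn mulrDr mulr1.
  move: IH1; rewrite /mut_vertex /=.
  by case: (odd k) => /= ->; rewrite !expr0 subn0 subn1 !mulr1 ?mul1r.
have -> : mut_vertex k.+2 = mut_vertex k by rewrite /mut_vertex /= negbK.
by rewrite IH1 /mut_vertex /=; case: (odd k).
Qed.

Lemma stable_transform k : (0 < k)%N ->
  transform (stable_mx k) (Fpoly k) = transform 1%:M (stable_poly k).
Proof.
move=> k0; rewrite stable_mxE //.
(* Reversing the index gives matching factors the same multiplicity [k - i]. *)
have -> : stable_poly k = \prod_(i < k) (1 + 'X_[step_mnm (k - i.+1)]) ^+ (k - i).
  rewrite /stable_poly (reindex_inj rev_ord_inj) /=.
  by apply: eq_bigr => i _; rewrite subnSK.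
apply: transform_prod => i _; have := ltn_ord i; move: (nat_of_ord i) => {}i ik.
(* The matrix [odd_form k] sends (i+1, i) to (k-i, k-i-1); as i < k, no subtraction is truncated. *)
rewrite mul1mx; apply/matrixP => u v; rewrite !mxE !big_ord_recl big_ord0 !mxE !mnmE /=.
by rewrite /bump /= !subn0 !subn1; elim/ord2_ind: u => /=; nia.
Qed.

Theorem theorem4p6 :
  exists F : nat -> {mpoly int[2]},
    (forall k : nat, (0 < k)%N -> tofrac (F k) = Flabel k) /\
    (forall k : nat, (0 < k)%N ->
       nonneg_exponents (transform (stable_mx k) (F k))) /\
    (forall m : 'X_{1..2}, exists (c : int) (K : nat), forall k : nat,
       (K <= k)%N ->
       coeff (exponent m) (transform (stable_mx k) (F k)) = c).
Proof.
exists Fpoly; split=> [[|k] // _|]; first by rewrite /Flabel; case: (labelE k).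
split=> [k k0|m]; first by rewrite stable_transform //; apply: transform1_nonneg.
(* Passing from [k] to [k.+1] adds a factor whose monomial has degree 2k+1, which exceeds [mdeg m]
   in this range. The threshold is not sharp, but it also forces [0 < k]. *)
exists (stable_poly (mdeg m).+1)@_m, (mdeg m).+1 => k lt_mk.
rewrite stable_transform ?coeff_transform1; last by apply: leq_trans lt_mk.
rewrite -(subnK lt_mk); elim: (k - _)%N => [|d IH] //.
rewrite addSn -IH [stable_poly _.+1]big_ord_recr /= mcoeff_mul1X //.
by rewrite mdeg_step_mnm; lia.
Qed.
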